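(* Let $n\ge 2$. For every Schur-positive set $A\subseteq \mathcal{S}_{n-1}$, the set $AC_n\subseteq \mathcal{S}_n$ is Schur-positive. Additionally, $$\mathcal{Q}(AC_n)=\mathcal{Q}(A)\,s_1,$$ where $\mathcal{Q}(A)$ is computed regarding $A$ as a subset of $\mathcal{S}_{n-1}$ (so it is homogeneous of degree $n-1$) and $\mathcal{Q}(AC_n)$ is computed regarding $AC_n$ as a subset of $\mathcal{S}_n$.
   Context: $\mathcal{S}_m$ is the symmetric group on $[m]=\{1,\dots,m\}$. For $\pi\in\mathcal{S}_m$, $\mathrm{Des}(\pi)=\{i\in[m-1]:\pi(i)>\pi(i+1)\}$. For $D\subseteq[m-1]$ the fundamental quasisymmetric function is $$F_{m,D}(\mathbf{x})=\sum_{\substack{i_1\le i_2\le\cdots\le i_m\\ i_j<i_{j+1}\text{ if }j\in D}}x_{i_1}x_{i_2}\cdots x_{i_m},$$ in the variables $\mathbf{x}=(x_1,x_2,\dots)$. For $B\subseteq\mathcal{S}_m$ set $\mathcal{Q}(B)=\sum_{\pi\in B}F_{m,\mathrm{Des}(\pi)}$. The set $B$ is called Schur-positive if $\mathcal{Q}(B)$ is a symmetric function whose expansion in the basis of Schur functions $s_\lambda$ has nonnegative coefficients. Here $s_1=x_1+x_2+\cdots$. Let $c=(1,2,\dots,n)\in\mathcal{S}_n$ be the $n$-cycle ($c(i)=i+1$ for $i<n$, $c(n)=1$) and $C_n=\{c^k:0\le k<n\}$. A set $A\subseteq\mathcal{S}_{n-1}$ is identified with a subset of $\mathcal{S}_n$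 by identifying $\mathcal{S}_{n-1}$ with the permutations in $\mathcal{S}_n$ that fix $n$. Then $AC_n=\{\pi c^k:\pi\in A,\ 0\le k<n\}$, with product $(\pi c^k)(i)=\pi(c^k(i))$; in one-line notation $$AC_n=\{\pi(k+1)\pi(k+2)\cdots\pi(n-1)\,n\,\pi(1)\pi(2)\cdots\pi(k):\pi\in A,\ 0\le k<n\}.$$ All these elements are distinct for distinct pairs $(\pi,k)$. *)

(* Defs.v *)
From mathcomp Require Import all_boot all_order all_algebra all_fingroup.
From mathcomp Require Import finmap multiset.
From mathcomp Require Import boolp classical_sets functions cardinality fsbigop.

Set Implicit Arguments.
Unset Strict Implicit.
Unset Printing Implicit Defensive.

Import Order.TTheory GRing.Theory Num.Theory.
Local Open Scope classical_set_scope.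
Local Open Scope ring_scope.

(* A formal power series with integer coefficients in countably many variables,
   indexed by nat (so the variables are x_0, x_1, ... instead of x_1, x_2, ...).
   A monomial is the multiset of the indices of its variables; a series maps a
   monomial to its coefficient. *)
Notation monomial := {mset nat}%mset.
Definition series := monomial -> int.

(* All the [\sum_(_ \in _)] below range over finite sets, so the convention that
   such a sum is 0 when its support is infinite never applies. *)

Definition series_mul (f g : series) : series := fun u =>
  \sum_(p \in [set p : monomial * monomial | (p.1 `+` p.2)%mset = u])
    f p.1 * g p.2.

(* The sum over t in S of the monomials w t, each of which is assumed to arise
   from finitely many t. *)
Definition gen_series (T : choiceType) (S : set T) (w : T -> monomial) : series :=
  fun u => \sum_(t \in [set t | S t /\ w t = u]) (1 : int).

Definition permute_vars (s : nat -> nat) (u : monomial) : monomial :=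
  seq_mset (map s u).

Definition symmetric_function (f : series) : Prop :=
  (exists d : nat, forall u : monomial, (d < size u)%N -> f u = 0) /\
  (forall s : nat -> nat, bijective s -> forall u, f (permute_vars s u) = f u).

Definition is_intpart (l : seq nat) : bool := sorted geq l && (0%N \notin l).
Definition intpart := {l : seq nat | is_intpart l}.

(* T is the sequence of its rows, from top to bottom in English notation. *)
Definition ssyt (l : intpart) : set (seq (seq nat)) :=
  [set T | [/\ shape T = val l,
               forall r, r \in T -> sorted leq r &
               forall i j : nat, (j < nth 0%N (val l) i.+1)%N ->
                 (nth 0%N (nth [::] T i) j < nth 0%N (nth [::] T i.+1) j)%N]].

Definition schur (l : intpart) : series :=
  gen_series (ssyt l) (fun T => seq_mset (flatten T)).

Definition part1 : intpart := exist _ [:: 1%N] isT.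
Definition s1 : series := schur part1.

Definition schur_positive_function (f : series) : Prop :=
  symmetric_function f /\
  exists c : {fsfun intpart -> int with 0},
    (forall l, 0 <= c l) /\
    (forall u, f u = (\sum_(l <- finsupp c) c l * schur l u)).

(* The position i in [m-1] is represented by i.-1 : 'I_m.-1. *)
Definition fundamental (m : nat) (D : {set 'I_m.-1}) : series :=
  gen_series
    [set s : m.-tuple nat | forall k : 'I_m.-1,
       (nth 0%N s k <= nth 0%N s k.+1)%N /\
       (k \in D -> (nth 0%N s k < nth 0%N s k.+1)%N)]
    (fun s => seq_mset s).

Definition one_line (m : nat) (p : 'S_m) : seq nat :=
  [seq val (p i) | i <- enum 'I_m].

Definition Des (m : nat) (p : 'S_m) : {set 'I_m.-1} :=
  [set k : 'I_m.-1 | (nth 0%N (one_line p) k.+1 < nth 0%N (one_line p) k)%N]%SET.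

Definition Qsym (m : nat) (B : {set 'S_m}) : series := fun u =>
  \sum_(p in B) fundamental (Des p) u.

Definition schur_positive (m : nat) (B : {set 'S_m}) : Prop :=
  schur_positive_function (Qsym B).

Definition rot_cycle (n : nat) : 'S_n := perm (@ordS_inj n).

Definition fix_last (m : nat) (p : 'S_m) : 'S_m.+1 :=
  lift_perm ord_max ord_max p.

Definition rotations (n : nat) : {set 'S_n} :=
  [set (rot_cycle n ^+ (k : nat))%g | k : 'I_n]%SET.

(* The product of permutations in the library is (s * t) x = t (s x), hence the
   factors appear in the opposite order to functional composition. *)
Definition mul_rotations (m : nat) (A : {set 'S_m}) : {set 'S_m.+1} :=
  (rotations m.+1 * (@fix_last m @: A)%SET)%g.

(* Main.v *)
From mathcomp Require Import zify.
Require Import Defs.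
From mathcomp Require Import all_boot all_algebra all_fingroup.
From mathcomp Require Import finmap multiset.
From mathcomp Require Import boolp classical_sets fsbigop.

Set Implicit Arguments.
Unset Strict Implicit.
Unset Printing Implicit Defensive.

Import GRing.Theory Num.Theory.

(* A monomial u of degree m + 1 is a sorted word w. For a permutation p of [m],
   the coefficient of u in the sum of the fundamental functions of the m + 1
   rotations of the word p(1) ... p(m) (m + 1) counts the rotations whose
   descents are strict ascents of w. Rotating w instead, this is the sum, over
   the distinct letters x of w, of the coefficient in F_(Des p) of the monomial
   u / x after a cyclic relabelling of its variables. For a single p this differs
   from the sum of the coefficients of the u / x, which is the coefficient of u
   in F_(Des p) s_1; after summation over A the two agree, because Q(A) is
   symmetric. Schur positivity then follows from the Pieri rule for one box,
   obtained from row insertion. *)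

(** * Row insertion *)

Definition row_pos (x : nat) (r : seq nat) : nat := find (fun y => x < y) r.

(** Schensted insertion: the leftmost entry larger than [x] is bumped into the next row. If there is
    none, [row_pos x r] is [size r] and [set_nth] appends [x]. *)
Fixpoint row_insert (T : seq (seq nat)) (x : nat) : seq (seq nat) :=
  if T is r :: T' then
    let i := row_pos x r in
    set_nth 0 r i x :: (if i < size r then row_insert T' (nth 0 r i) else T')
  else [:: [:: x]].

Definition row_above (r s : seq nat) : bool :=
  (size s <= size r) && all (fun j => nth 0 r j < nth 0 s j) (iota 0 (size s)).

(** Recursive counterpart of [ssyt], suited to induction along insertion. Below the last row [head]
    yields the empty row, for which [row_above] holds trivially. *)
Fixpoint is_tableau (T : seq (seq nat)) : bool :=
  if T is r :: T' then
    [&& sorted leq r, r != [::], row_above r (head [::] T') & is_tableau T']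
  else true.

Lemma row_aboveP r s :
  reflect (size s <= size r /\ forall j, j < size s -> nth 0 r j < nth 0 s j)
    (row_above r s).
Proof.
apply: (iffP andP) => -[sz H]; split=> //.
  by move=> j js; apply: (allP H); rewrite mem_iota.
by apply/allP => j; rewrite mem_iota /= => /H.
Qed.

Lemma row_sortedP r :
  reflect (forall i j, i <= j -> j < size r -> nth 0 r i <= nth 0 r j)
    (sorted leq r).
Proof.
apply: (iffP idP) => [sr i j ij jr|H].
  by rewrite (sorted_leq_nth leq_trans leqnn) // inE; apply: leq_ltn_trans jr.
by apply/(sortedP 0) => i ir; apply: H.
Qed.

Lemma row_pos_le x r : row_pos x r <= size r.
Proof. exact: find_size. Qed.

Lemma nth_row_pos x r : row_pos x r < size r -> x < nth 0 r (row_pos x r).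
Proof. by move=> h; apply: (nth_find 0 (a := fun y => x < y)); rewrite has_find. Qed.

Lemma nth_lt_row_pos x r i : i < row_pos x r -> nth 0 r i <= x.
Proof. by move=> h; have := before_find 0 h; rewrite ltnNge => /negbFE. Qed.

Lemma row_posP x r i :
  i <= size r -> (forall j, j < i -> nth 0 r j <= x) ->
  (i < size r -> x < nth 0 r i) -> row_pos x r = i.
Proof.
move=> ir Hlt Hge; case: (ltngtP (row_pos x r) i) => // h.
  have hr := leq_trans h ir.
  by have := nth_row_pos hr; rewrite ltnNge Hlt.
have := nth_lt_row_pos h; rewrite leqNgt Hge //.
exact: leq_trans h (row_pos_le _ _).
Qed.

Lemma size_set_nth_le (r : seq nat) i x :
  i <= size r -> size (set_nth 0 r i x) = (i == size r) + size r.
Proof. rewrite size_set_nth; lia. Qed.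

Lemma sorted_set_nth r i x : sorted leq r -> i <= size r ->
  (forall j, j < i -> nth 0 r j <= x) ->
  (forall j, i < j -> j < size r -> x <= nth 0 r j) ->
  sorted leq (set_nth 0 r i x).
Proof.
move=> /row_sortedP sr ir Hl Hr; apply/row_sortedP => a b ab.
rewrite size_set_nth_le // !nth_set_nth /= => bs.
case: (a =P i) => [ai|/eqP ai]; case: (b =P i) => [bi|/eqP bi] //.
- by apply: Hr; lia.
- by apply: Hl; lia.
- by apply: sr => //; lia.
Qed.

Lemma head_row_insert T x :
  head [::] (row_insert T x) =
  set_nth 0 (head [::] T) (row_pos x (head [::] T)) x.
Proof. by case: T. Qed.

(** A bumped letter moves down and weakly to the left, so it lands under a letter smaller than
    itself and columns stay strict. *)
Lemma row_insert_tableau T x : is_tableau T -> is_tableau (row_insert T x).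
Proof.
elim: T x => [|r T IH] x //= /and4P[sr rn rs tT].
set i := row_pos x r; have ir : i <= size r := row_pos_le x r.
have -> /= : sorted leq (set_nth 0 r i x).
  apply: sorted_set_nth => // j; first exact: nth_lt_row_pos.
  move=> ij jr; have := nth_row_pos (leq_ltn_trans (ltnW ij) jr).
  by move/row_sortedP: sr => /(_ i j (ltnW ij) jr); rewrite -/i; lia.
have -> /= : set_nth 0 r i x != [::].
  by rewrite -size_eq0 size_set_nth; lia.
have /row_aboveP[szs lts] := rs.
case: ltnP => hi; last first.
  rewrite tT andbT; apply/row_aboveP; split=> [|j js].
    by rewrite size_set_nth; lia.
  by rewrite nth_set_nth /=; case: eqP => [?|_]; [lia | exact: lts].
rewrite IH // andbT head_row_insert; set s := head [::] T in rs szs lts *.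
set y := nth 0 r i; set j := row_pos y s.
have js : j <= size s := row_pos_le y s.
(* If [i < j], the entry of [s] below [y] would be at most [y], against column strictness. *)
have ji : j <= i.
  rewrite leqNgt; apply/negP => lij; have := nth_lt_row_pos lij.
  have ltis : i < size s by lia.
  by have := lts _ ltis; rewrite -/y; lia.
have xy : x < y by apply: nth_row_pos.
apply/row_aboveP; split=> [|c]; rewrite !size_set_nth_le //.
  case: (j =P size s) => /= [je|_]; [|by lia].
  case: (i =P size r) => /=; lia.
rewrite !nth_set_nth /= => cs.
case: (c =P j) => [cj|cj]; case: (c =P i) => [ci|ci] //.
- have ltci : c < i by lia.
  by have := nth_lt_row_pos ltci; lia.
- have ltcs : c < size s by lia.
  by have := lts _ ltcs; rewrite ci -/y; lia.
- by apply: lts; lia.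
Qed.

Lemma perm_set_nth (r : seq nat) i x : i < size r ->
  perm_eq (nth 0 r i :: set_nth 0 r i x) (x :: r).
Proof.
move=> ir; rewrite set_nthE ir -{4}(cat_take_drop i r) (drop_nth 0 ir).
apply/seq.permP => p /=; rewrite !count_cat /=; lia.
Qed.

Lemma set_nth_rcons (r : seq nat) x : set_nth 0 r (size r) x = rcons r x.
Proof. by elim: r => //= a r ->. Qed.

Lemma perm_row_insert T x :
  perm_eq (flatten (row_insert T x)) (x :: flatten T).
Proof.
elim: T x => [|r T IH] x //=.
case: ltnP => hi.
  have /seq.permP H1 := IH (nth 0 r (row_pos x r)).
  have /seq.permP H2 := perm_set_nth x hi.
  apply/seq.permP => p; move: (H1 p) (H2 p); rewrite /= !count_cat; lia.
have -> : row_pos x r = size r by have := row_pos_le x r; lia.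
rewrite set_nth_rcons cat_rcons.
by rewrite -(cat1s x (r ++ _)) -(cat1s x (flatten _)) perm_catCA.
Qed.

(** The bumping stops at the row [k] where a letter is appended; [k = size T] means that a new row
    is opened. *)
Lemma shape_row_insert T x :
  exists2 k, k <= size T & shape (row_insert T x) = incr_nth (shape T) k.
Proof.
elim: T x => [|r T IH] x /=; first by exists 0.
case: ltnP => hi.
  have [k kT /= ->] := IH (nth 0 r (row_pos x r)); exists k.+1 => //=.
  by rewrite size_set_nth_le 1?ltnW // ltn_eqF.
have -> : row_pos x r = size r by have := row_pos_le x r; lia.
by exists 0 => //; rewrite size_set_nth_le // eqxx.
Qed.

(** Equal shapes before and after force both top rows to bump or both to append. In the first case
    induction gives the same lower rows and the same bumped letter, which determine the top row and
    the inserted letter. *)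
Lemma row_insert_inj T1 T2 x1 x2 : is_tableau T1 -> is_tableau T2 ->
  shape T1 = shape T2 -> row_insert T1 x1 = row_insert T2 x2 ->
  T1 = T2 /\ x1 = x2.
Proof.
elim: T1 T2 x1 x2 => [|r1 T1 IH] [|r2 T2] x1 x2 //=.
  by move=> _ _ _ [->].
move=> /and4P[/row_sortedP s1 _ _ t1] /and4P[/row_sortedP s2 _ _ t2] [sz shT].
set i1 := row_pos x1 r1; set i2 := row_pos x2 r2 => -[E ET].
have i1r : i1 <= size r1 := row_pos_le x1 r1.
have i2r : i2 <= size r2 := row_pos_le x2 r2.
have szE := congr1 size E; rewrite !size_set_nth_le // in szE.
have nE c := congr1 (fun r => nth 0 r c) E.
case: (ltnP i1 (size r1)) (ltnP i2 (size r2)) ET => h1 [] h2 ET;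
  try by move: szE; lia.
  have [eT ey] := IH _ _ _ t1 t2 shT ET.
  have x1y : x1 < nth 0 r1 i1 := nth_row_pos h1.
  have x2y : x2 < nth 0 r2 i2 := nth_row_pos h2.
  (* If [i1 < i2], the entry of [r1] at [i2] is [x2]; but it is at least the common bumped letter,
     which exceeds [x2]. The other case is symmetric. *)
  have i12 : i1 = i2.
    case: (ltngtP i1 i2) => // lti.
      have := nE i2; rewrite !nth_set_nth /= eqxx gtn_eqF //.
      by have := s1 i1 i2; lia.
    have := nE i1; rewrite !nth_set_nth /= eqxx gtn_eqF //.
    by have := s2 i2 i1; lia.
  have xx : x1 = x2.
    by have := nE i1; rewrite !nth_set_nth /= i12 eqxx.
  split=> //; congr cons => //; apply: (eq_from_nth (x0 := 0)) => // c _.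
  have := nE c; rewrite !nth_set_nth /= -i12.
  by case: eqP => [->|//]; rewrite {2}i12.
have e1 : i1 = size r1 by lia.
have e2 : i2 = size r2 by lia.
move: E; rewrite e1 e2 !set_nth_rcons => /rcons_inj[-> ->].
by rewrite ET.
Qed.

(** Finds the entry ejected in reverse insertion: the rightmost one smaller than [y]. *)
Lemma last_lt_pos r j y : sorted leq r -> j < size r -> nth 0 r j < y ->
  exists i, [/\ j <= i, i < size r, nth 0 r i < y &
                forall c, i < c -> c < size r -> y <= nth 0 r c].
Proof.
move=> /row_sortedP sr jr ry; set p := fun i => (i < size r) && (nth 0 r i < y).
have pj : exists i, p i by exists j; apply/andP.
have pb i : p i -> i <= size r by case/andP=> /ltnW.
case: (ex_maxnP pj pb) => i /andP[ir xi] maxi.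
exists i; split=> // [|c ic cr]; first by apply: maxi; apply/andP.
rewrite leqNgt; apply/negP => cy.
by have := maxi c; rewrite /p cr cy leqNgt ic => /(_ isT).
Qed.

(** Reverse insertion, starting from the box at the end of row [k]. For [k = 0] the last letter of
    the top row is taken off; otherwise the lower rows eject some [y], which replaces the rightmost
    smaller entry of the top row, and that entry is ejected in turn. *)
Lemma row_insert_surj l T' k : is_tableau T' -> sorted geq l -> 0 \notin l ->
  k <= size l -> shape T' = incr_nth l k ->
  exists T x, [/\ is_tableau T, shape T = l & row_insert T x = T'].
Proof.
elim: T' l k => [|r' T' IH] [|a l] [|k] //=.
- move=> /and4P[_ _ _ _] _ _ _ [sr' shT].
  case: T' shT {IH} => // _; case: r' sr' => [|x []] // _.
  by exists [::], x.
- move=> /and4P[sr rn /row_aboveP[sz ltr] tT'] sl n0 _ [sr' shT].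
  case/lastP: r' sr rn sz ltr sr' => // r x sr rn sz ltr.
  rewrite size_rcons => -[sra].
  have r0 : r != [::].
    by rewrite -size_eq0 sra; move: n0; rewrite inE negb_or eq_sym => /andP[].
  (* As [l] is a partition, the shortened top row still covers the row below it. *)
  have srs : size (head [::] T') <= size r.
    rewrite sra -shT in sl *; case: (T') sl => [|s T0] //= /andP[] //.
  exists (r :: T'), x; split=> //=; last 2 first.
  - by rewrite sra shT.
  - have -> : row_pos x r = size r.
      apply: row_posP => // [j js|]; last by rewrite ltnn.
      move/row_sortedP: sr => /(_ j (size r)); rewrite size_rcons.
      by rewrite !nth_rcons ltnn eqxx js; apply; lia.
    by rewrite ltnn set_nth_rcons.
  rewrite r0 tT' andbT; apply/and3P; split=> //.
    move: sr; rewrite -cats1 => /(subseq_sorted leq_trans); apply.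
    exact: prefix_subseq.
  apply/row_aboveP; split=> // j js.
  by have := ltr _ js; rewrite nth_rcons (leq_trans js srs).
- move=> /and4P[sr rn /row_aboveP[sz ltr] tT'] sl n0 kl [sr' shT].
  have sl' : sorted geq l := path_sorted sl.
  have n0' : 0 \notin l by move: n0; rewrite inE negb_or => /andP[].
  have [T [y [tT shTl ET]]] := IH l k tT' sl' n0' kl shT.
  set s := head [::] T; set j := row_pos y s.
  have js : j <= size s := row_pos_le _ _.
  have hT' : head [::] T' = set_nth 0 s j y by rewrite -ET head_row_insert.
  rewrite hT' in sz ltr.
  rewrite size_set_nth_le // in sz ltr.
  (* In the given tableau [y] stands in column [j] of the second row, under a smaller letter. *)
  have ry : nth 0 r' j < y.
    have := ltr j; rewrite nth_set_nth /= eqxx; apply.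
    by clear -js; case: eqP js => /=; lia.
  have jr' : j < size r'.
    by apply: leq_trans sz; clear -js; case: eqP js => /=; lia.
  have /row_sortedP sr2 := sr.
  have [i [ji ir xi gti]] := last_lt_pos sr jr' ry.
  set x := nth 0 r' i in xi.
  pose r := set_nth 0 r' i y.
  have szr : size r = size r' by rewrite size_set_nth_le 1?ltnW // ltn_eqF.
  have nr c : nth 0 r c = if c == i then y else nth 0 r' c by rewrite nth_set_nth.
  have pr : row_pos x r = i.
    apply: row_posP; rewrite ?szr ?nr ?eqxx //; first exact: ltnW.
    by move=> c ci; rewrite nr ltn_eqF //; apply: sr2; rewrite // ltnW.
  exists (r :: T), x; split=> /=; last 2 first.
  - by rewrite szr sr' shTl.
  - rewrite pr szr ir nr eqxx ET /r set_set_nth eqxx; congr cons.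
    apply: (eq_from_nth (x0 := 0)) => [|c _]; last first.
      by rewrite nth_set_nth /=; case: eqP => // ->.
    by rewrite size_set_nth_le 1?ltnW // ltn_eqF.
  rewrite tT andbT; apply/and3P; split.
  - apply: sorted_set_nth => //; first exact: ltnW.
    by move=> c ci; apply: leq_trans (ltnW xi); apply: sr2 => //; apply: ltnW.
  - by rewrite -size_eq0 szr -lt0n (leq_ltn_trans _ ir).
  apply/row_aboveP; rewrite szr -/s; split=> [|c cs].
    by apply: leq_trans sz; rewrite leq_addl.
  have := ltr c; rewrite nr nth_set_nth /=.
  case: (c =P i) => [ci|ci].
    move=> _; have jss : j < size s by rewrite (leq_ltn_trans ji) // -ci.
    have := nth_row_pos jss.
    have : nth 0 s j <= nth 0 s c.
      have /row_sortedP : sorted leq s.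
        by rewrite /s; case: (T) tT => //= ? ? /and4P[].
      by apply; lia.
    by rewrite -/j; lia.
  case: (c =P j) => [cj|cj]; last by apply; lia.
  have jss : j < size s by rewrite -cj.
  by have := nth_row_pos jss; rewrite -/j cj; lia.
Qed.

(** * Pieri rule for one box *)

Lemma gen_series_size (T : choiceType) (S : set T) (w : T -> monomial) u r :
  uniq r -> (forall t, t \in r <-> S t /\ w t = u) ->
  gen_series S w u = ((size r)%:Z)%R.
Proof.
move=> ur rP; rewrite /gen_series.
have -> : [set t | S t /\ w t = u]%classic = [set` r]%classic.
  by apply/seteqP; split=> t /= /rP.
by rewrite -(fsbig_seq _ _ ur) big_const_seq count_predT iter_addr addr0 -natz.
Qed.

(** A tableau of shape [l] is recovered from its reading word by [reshape l], so the finitely many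
    orderings of [v] yield all candidates. *)
Definition tableaux (l : seq nat) (v : monomial) : seq (seq (seq nat)) :=
  [seq T <- undup [seq reshape l w | w <- permutations v]
     | [&& is_tableau T, shape T == l & seq_mset (flatten T) == v]].

Lemma tableauxP l v T :
  reflect [/\ is_tableau T, shape T = l & seq_mset (flatten T) = v]
    (T \in tableaux l v).
Proof.
rewrite mem_filter mem_undup.
apply: (iffP andP) => [[/and3P[tT /eqP sT /eqP vT] _]//|].
move=> [-> <- <-]; rewrite !eqxx; split=> //.
apply/mapP; exists (flatten T); last by rewrite flattenK.
by rewrite mem_permutations perm_sym perm_eq_seq_mset.
Qed.

Lemma is_tableauP T :
  is_tableau T <->
  (forall r, r \in T -> sorted leq r /\ r != [::]) /\
  (forall i, row_above (nth [::] T i) (nth [::] T i.+1)).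
Proof.
elim: T => [|r T IH] /=; first by split=> // _; split=> // i; rewrite nth_nil.
split=> [/and4P[sr rn rT /IH[H1 H2]]|[H1 H2]].
  split=> [s|[|i]]; last exact: H2; last by move: rT; rewrite -nth0.
  by rewrite inE => /predU1P[->//|/H1].
have [-> ->] := H1 r (mem_head _ _); rewrite -nth0 (H2 0) /=.
by apply/IH; split=> [s sT|i]; [apply: H1; rewrite inE sT orbT | apply: (H2 i.+1)].
Qed.

Lemma is_intpart_shape T : is_tableau T -> is_intpart (shape T).
Proof.
move=> /is_tableauP[H1 H2]; apply/andP; split.
  apply/(sortedP 0) => i _ /=; rewrite !nth_shape.
  by have /row_aboveP[] := H2 i.
apply/mapP => -[r /H1[_ rn] r0]; by rewrite -size_eq0 -r0 in rn.
Qed.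

Lemma ssyt_tableau (l : intpart) T : ssyt l T <-> is_tableau T /\ shape T = val l.
Proof.
have /andP[sl l0] := valP l.
split=> [[shT sr sc]|[tT shT]].
  split=> //; apply/is_tableauP; split=> [r rT|i].
    split; first exact: sr.
    apply: contra l0 => /eqP r0; rewrite -shT; apply/mapP.
    by exists r => //; rewrite r0.
  apply/row_aboveP; split=> [|j]; last by rewrite -nth_shape shT => /sc.
  rewrite -!nth_shape shT; case: (ltnP i.+1 (size (val l))) => il.
    by move/(sortedP 0) : sl; apply.
  by rewrite nth_default.
have /is_tableauP[H1 H2] := tT; split=> // [r /H1[]//|i j].
by rewrite -shT nth_shape; have /row_aboveP[_] := H2 i; apply.
Qed.

(** The right-hand side is the Kostka number of shape [l] and content [v]. *)
Lemma schurE l v : schur l v = ((size (tableaux (val l) v))%:Z)%R.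
Proof.
apply: gen_series_size => [|T]; first by rewrite filter_uniq ?undup_uniq.
split=> [/tableauxP[tT sT <-]|[/ssyt_tableau[tT sT] <-]]; last exact/tableauxP.
by split=> //; apply/ssyt_tableau.
Qed.

(** [insub] discards the results that are not partitions; the index [size (val l)] opens a new
    row. *)
Definition add_box (l : intpart) : seq intpart :=
  pmap insub [seq incr_nth (val l) k | k <- iota 0 (size (val l)).+1].

Lemma add_box_uniq l : uniq (add_box l).
Proof.
by apply: pmap_sub_uniq; rewrite map_inj_uniq ?iota_uniq //; apply: incr_nth_inj.
Qed.

Lemma add_boxP l l' :
  reflect (exists2 k, k <= size (val l) & val l' = incr_nth (val l) k)
    (l' \in add_box l).
Proof.
rewrite mem_pmap_sub; apply: (iffP mapP) => -[k kl E]; exists k => //.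
  by rewrite mem_iota in kl.
by rewrite mem_iota.
Qed.

(* Row insertion is a bijection from the pairs (T, x) onto the tableaux whose
   shape is the shape of T with one more box. *)
Lemma pieri_box (l : intpart) (u : monomial) :
  (\sum_(x <- undup u) schur l (u `\ x)%mset =
   \sum_(l' <- add_box l) schur l' u)%R.
Proof.
pose L := [seq (T, x) | x <- undup u, T <- tableaux (val l) (u `\ x)%mset].
pose R := [seq T | l' <- add_box l, T <- tableaux (val l') u].
have -> : (\sum_(x <- undup u) schur l (u `\ x)%mset = (size L)%:Z)%R.
  rewrite size_allpairs_dep sumnE big_map -natz natr_sum.
  by apply: eq_bigr => x _; rewrite schurE natz.
have -> : (\sum_(l' <- add_box l) schur l' u = (size R)%:Z)%R.
  rewrite size_allpairs_dep sumnE big_map -natz natr_sum.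
  by apply: eq_bigr => x _; rewrite schurE natz.
have /andP[sl l0] := valP l.
have LP T x : reflect
    [/\ is_tableau T, shape T = val l & seq_mset (x :: flatten T) = u]
    ((T, x) \in L).
  apply: (iffP allpairsPdep) =>
    [[x' [T' [xu /tableauxP[tT sT vT] [-> ->]]]]|[tT sT <-]].
    by rewrite mset_cons vT msetB1K // -mem_undup.
  exists x, T; split=> //; first by rewrite mem_undup mset_cons mset1D1.
  by apply/tableauxP; split=> //; rewrite mset_cons msetD1K.
have tabu l1 v : uniq (tableaux l1 v) by rewrite filter_uniq ?undup_uniq.
suff /perm_size : perm_eq [seq row_insert p.1 p.2 | p <- L] R.
  by rewrite size_map => ->.
apply: uniq_perm.
- rewrite map_inj_in_uniq.
    apply: allpairs_uniq_dep => //; first exact: undup_uniq.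
    by move=> [x1 T1] [x2 T2] _ _ /= [-> ->].
  move=> [T1 x1] [T2 x2] /LP[t1 s1 _] /LP[t2 s2 _] /= E.
  by have [|-> ->//] := row_insert_inj t1 t2 _ E; rewrite s1.
(* A tableau determines its shape, so none is listed under two partitions. *)
- apply: allpairs_uniq_dep => //; first exact: add_box_uniq.
  move=> p1 p2 /allpairsPdep[l1 [T1 [_ /tableauxP[_ s1 _] E1]]].
  move=> /allpairsPdep[l2 [T2 [_ /tableauxP[_ s2 _] E2]]].
  rewrite {}E1 {}E2 /= => E; rewrite -E s1 in s2; rewrite -E.
  by rewrite (val_inj s2).
move=> T'; apply/mapP/allpairsPdep => [[[T x] /LP[tT sT uT] E]|].
  have tT' := row_insert_tableau x tT.
  have pT' := is_intpart_shape tT'.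
  have [k kT sT'] := shape_row_insert T x.
  pose l' : intpart := Sub (shape (row_insert T x)) pT'.
  exists l', (row_insert T x); split; last exact: E.
    apply/add_boxP; exists k; last by rewrite /= sT' sT.
    by rewrite -sT size_map.
  apply/tableauxP; split=> //; rewrite -uT; apply/eq_seq_msetP.
  exact: perm_row_insert.
move=> [l' [T'' [/add_boxP[k kl El'] /tableauxP[tT sT uT] E]]]; rewrite {}E.
rewrite El' in sT.
have [T1 [x [t1 s1 E1]]] := row_insert_surj tT sl l0 kl sT.
exists (T1, x) => //; apply/LP; split=> //.
by rewrite -uT -E1; apply/eq_seq_msetP; rewrite perm_sym perm_row_insert.
Qed.

(** * Multiplication by the Schur function of one box *)

Lemma mset_size1 (p : monomial) : size p = 1 -> exists x, p = seq_mset [:: x].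
Proof.
move=> p1; rewrite -(seq_mset_id p).
by case: (enum_mset p) p1 => [|x []] // _; exists x.
Qed.

Lemma s1E (p : monomial) : s1 p = ((size p == 1)%:Z)%R.
Proof.
have ssyt1 T : ssyt part1 T <-> exists x, T = [:: [:: x]].
  rewrite ssyt_tableau; split=> [[_]|[x ->]//].
  by case: T => [|[|x []] []] //= _; exists x.
case: eqP => p1.
  have [x px] := mset_size1 p1.
  rewrite [LHS](@gen_series_size _ _ _ _ [:: [:: [:: x]]]) // => T.
  rewrite inE; split=> [/eqP->|[/ssyt1[y ->]]].
    by split=> //; apply/ssyt1; exists x.
  rewrite px => /eq_seq_msetP /perm_mem/(_ y).
  by rewrite !inE eqxx => /esym/eqP->.
rewrite [LHS](@gen_series_size _ _ _ _ [::]) // => T.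
split=> // -[/ssyt1[y ->]] E; case: p1; rewrite -E.
by rewrite (perm_size (perm_eq_seq_mset _)).
Qed.

(** Only factorizations of [u] whose second factor is a single variable contribute. Equal copies of
    a letter give the same factorization, hence [undup]. *)
Lemma series_mul_s1 (f : series) (u : monomial) :
  series_mul f s1 u = (\sum_(x <- undup u) f (u `\ x)%mset)%R.
Proof.
rewrite /series_mul.
pose r := [seq ((u `\ x)%mset, [mset x]%mset) | x <- undup u].
have rP (p : monomial * monomial) :
    p \in r <-> (p.1 `+` p.2)%mset = u /\ size p.2 = 1.
  split=> [/mapP[x]|[]].
    rewrite mem_undup => xu E; rewrite {}E /=.
    split; first by rewrite msetDC msetB1K.
    by rewrite enum_msetn.
  case: p => a b /= ab b1.
  have [x bx] : exists x, b = [mset x]%mset.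
    have [x ->] := mset_size1 b1; exists x; apply/msetP => y.
    by rewrite mset_seqE msetnE /= addn0 eq_sym; case: eqP.
  apply/mapP; exists x.
    by rewrite mem_undup -ab bx in_msetD in_mset1 eqxx orbT.
  by rewrite -ab bx msetDC msetD1K.
have ur : uniq r.
  rewrite map_inj_in_uniq ?undup_uniq // => x y _ _ [_].
  move/(congr1 (fun m : monomial => m x)).
  by rewrite !msetnE eqxx; case: eqP.
rewrite (fsbigE r) //; last 2 first.
- by move=> p /= /rP[].
- move=> p /= pu pr; rewrite s1E; case: eqP => [p2|_]; last by rewrite mulr0.
  by case/negP: pr; apply/rP.
rewrite big_seq_cond /=.
rewrite (eq_bigl (fun p => p \in r)) => [|p]; last first.
  by case: (boolP (p \in r)) => //= /rP[pu _]; apply/asboolP.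
rewrite -big_seq big_map; apply: eq_bigr => x _ /=.
by rewrite s1E enum_msetn mulr1.
Qed.

(** * Symmetry and Schur positivity of the product *)

Lemma size_msetB1 (u : monomial) x : x \in u -> size u = (size (u `\ x)%mset).+1.
Proof.
move=> xu; have : perm_eq u (x :: (u `\ x)%mset).
  rewrite -{1}(msetB1K xu) -{1}(seq_mset_id (u `\ x)%mset) -mset_cons.
  exact: perm_eq_seq_mset.
by move/perm_size.
Qed.

Lemma mem_permute_vars s (u : monomial) : permute_vars s u =i map s u.
Proof. by move=> x; rewrite (perm_mem (perm_eq_seq_mset _)). Qed.

Lemma permute_vars_cons s (x : nat) (t : seq nat) :
  permute_vars s (seq_mset (x :: t)) = (s x +` permute_vars s (seq_mset t))%mset.
Proof.
rewrite /permute_vars -mset_cons; apply/eq_seq_msetP => /=.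
rewrite -map_cons; apply: perm_map.
by rewrite (perm_trans (perm_eq_seq_mset _)) // perm_cons perm_sym perm_eq_seq_mset.
Qed.

Lemma permute_varsB1 s (u : monomial) x : x \in u ->
  permute_vars s (u `\ x)%mset = (permute_vars s u `\ s x)%mset.
Proof.
move=> xu; rewrite -{2}(msetB1K xu) -{2}(seq_mset_id (u `\ x)%mset) -mset_cons.
by rewrite permute_vars_cons msetD1K seq_mset_id.
Qed.

(** The degree bound grows by one, and a bijection of the variables carries the distinct letters of
    [u] to those of its image, matching the two sums over removed letters. *)
Lemma symmetric_mul_s1 f :
  symmetric_function f -> symmetric_function (series_mul f s1).
Proof.
move=> [[d Hd] Hs]; split.
  exists d.+1 => u du; rewrite series_mul_s1 big_seq big1 // => x.
  by rewrite mem_undup => xu; apply: Hd; rewrite (size_msetB1 xu) in du.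
move=> s bs u; rewrite !series_mul_s1.
have pu : perm_eq (undup (permute_vars s u)) (map s (undup u)).
  have -> : map s (undup u) = undup (map s u).
    by rewrite undup_map_inj //; apply: bij_inj.
  apply: uniq_perm; rewrite ?undup_uniq // => x.
  by rewrite !mem_undup mem_permute_vars.
rewrite (perm_big _ pu) big_map big_seq [RHS]big_seq; apply: eq_bigr => x.
by rewrite mem_undup => xu; rewrite -permute_varsB1 // Hs.
Qed.

(** By the Pieri rule the coefficient of [schur l'] in the product is the sum of [c l] over the [l]
    obtained from [l'] by removing a box. *)
Lemma schur_positive_mul_s1 f :
  schur_positive_function f -> schur_positive_function (series_mul f s1).
Proof.
move=> [fs [c [c0 fc]]]; split; first exact: symmetric_mul_s1.
pose c' l' : int := (\sum_(l <- finsupp c) c l * (l' \in add_box l)%:Z)%R.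
pose D := [fset l' in flatten [seq add_box l | l <- finsupp c]]%fset.
pose C : {fsfun intpart -> int with 0%R} := [fsfun l' in D => c' l' | 0%R]%fset.
have DP l l' : l \in finsupp c -> l' \in add_box l -> l' \in D.
  by move=> lc ll; rewrite inE; apply/flattenP; exists (add_box l); rewrite ?map_f.
have CE l' : C l' = c' l'.
  rewrite fsfunE; case: ifPn => // Dl'; rewrite /c' big_seq big1 // => l lc.
  case: (boolP (l' \in add_box l)) => [ll|_]; last by rewrite mulr0.
  by rewrite (DP _ _ lc ll) in Dl'.
exists C; split=> [l'|u].
  by rewrite CE; apply: sumr_ge0 => l _; apply: mulr_ge0.
(* Summing over [D], which may exceed the support of [C], gives an explicit range and allows the
   exchange of the two sums. *)
rewrite (big_fset_incl _ (B := D)) /=; last 2 first.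
- exact: finsupp_sub.
- by move=> l' _ lC; rewrite fsfun_dflt // mul0r.
under [RHS]eq_bigr do rewrite CE mulr_suml.
rewrite exchange_big series_mul_s1 /=.
under eq_bigr do rewrite fc.
rewrite exchange_big big_seq [RHS]big_seq /=; apply: eq_bigr => l lc.
rewrite -mulr_sumr pieri_box mulr_sumr.
rewrite [RHS](eq_bigr
  (fun l' => if l' \in add_box l then c l * schur l' u else 0)%R).
rewrite -big_mkcond -big_filter; apply: perm_big; apply: uniq_perm.
- exact: add_box_uniq.
- exact: filter_uniq (fset_uniq D).
- move=> l'; rewrite mem_filter.
  by case: (boolP (l' \in add_box l)) => //= /(DP _ _ lc).
by move=> l' _; case: (l' \in add_box l); rewrite ?mulr1 ?mulr0 ?mul0r.
Qed.

(** * Rotations *)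

Lemma nth_one_line n (q : 'S_n) (i : 'I_n) : nth 0 (one_line q) i = q i.
Proof. by rewrite (nth_map i) ?size_enum_ord // nth_ord_enum. Qed.

Lemma nth_one_line_lt n (q : 'S_n) i : i < n -> nth 0 (one_line q) i < n.
Proof. by move=> lin; rewrite (nth_one_line q (Ordinal lin)). Qed.

Lemma fix_lastE m (p : 'S_m) (a : 'I_m.+1) :
  fix_last p a = (if a == m :> nat then m else nth 0 (one_line p) a) :> nat.
Proof.
rewrite /fix_last; case: (unliftP ord_max a) => [b ->|->].
  rewrite lift_perm_lift !lift_max nth_one_line.
  by rewrite ltn_eqF.
by rewrite lift_perm_id eqxx.
Qed.

Lemma fix_last_inj m : injective (@fix_last m).
Proof.
move=> p q E; apply/perm.permP => i; apply: (@lift_inj _ ord_max).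
by rewrite -!(lift_perm_lift ord_max ord_max) -/(fix_last p) E.
Qed.

Lemma rot_cycleX m k (j : 'I_m.+1) :
  (Defs.rot_cycle m.+1 ^+ k)%g j = (j + k) %% m.+1 :> nat.
Proof.
elim: k => [|k IH]; first by rewrite perm1 addn0 modn_small.
by rewrite expgSr permM permE /= IH -addn1 modnDml addn1 addnS.
Qed.

(** With indices and values starting at 0, the rotation reads [p] from index [k] on, then the
    largest value [m] at index [m - k], then the first [k] letters of [p]. *)
Lemma rotation_fix_lastE m (p : 'S_m) (k j : nat) : k <= m -> j <= m ->
  nth 0 (one_line (Defs.rot_cycle m.+1 ^+ k * fix_last p)%g) j =
  if j + k < m then nth 0 (one_line p) (j + k)
  else if j + k == m then m else nth 0 (one_line p) (j + k - m.+1).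
Proof.
move=> km jm; have jm1 : j < m.+1 by [].
rewrite (nth_one_line _ (Ordinal jm1)) permM fix_lastE rot_cycleX /=.
case: (ltngtP (j + k) m) => h.
- by rewrite modn_small ?ltn_eqF // ltnW // ltnS ltnW.
- have -> : (j + k) %% m.+1 = j + k - m.+1.
    have {1}-> : j + k = (j + k - m.+1) + m.+1 by lia.
    by rewrite modnDr modn_small //; lia.
  by case: eqP => //; lia.
- by rewrite h modn_small ?eqxx.
Qed.

(** The pairs [(k, p)] parametrize the product set without repetition: the index [m - k] of the
    largest value recovers [k], and cancelling the rotation then recovers [p]. *)
Lemma Qsym_mul_rotations m (A : {set 'S_m}) u :
  Qsym (mul_rotations A) u =
  (\sum_(k < m.+1) \sum_(p in A)
     fundamental (Des (Defs.rot_cycle m.+1 ^+ k * fix_last p)%g) u)%R.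
Proof.
pose f (kp : 'I_m.+1 * 'S_m) :=
  (Defs.rot_cycle m.+1 ^+ (kp.1 : nat) * fix_last kp.2)%g.
have f_inj : injective f.
  move=> [k p] [k' p'] E; have kk : k = k' :> nat.
    have := congr1 (fun q => nth 0 (one_line q) (m - k)) E.
    have km := ltn_ord k; have k'm := ltn_ord k'.
    rewrite /f /= !rotation_fix_lastE ?leq_subr // subnK // ltnn eqxx.
    case: ltnP => [h|_]; first by have := nth_one_line_lt p' h; lia.
    case: eqP => [?|ne]; first lia.
    move=> h; have h' : m - k + k' - m.+1 < m by lia.
    by have := nth_one_line_lt p' h'; lia.
  move: E; rewrite /f /= kk => /mulgI/fix_last_inj ->.
  by congr pair; apply: val_inj.
have -> : mul_rotations A = (f @: [set kp | kp.2 \in A])%SET.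
  apply/setP => q; apply/mulsgP/imsetP.
    move=> [_ _ /imsetP[k _ ->] /imsetP[p pA ->] ->].
    by exists (k, p); rewrite ?inE.
  move=> [[k p]]; rewrite inE /= => pA ->.
  exists (Defs.rot_cycle m.+1 ^+ k)%g (fix_last p) => //; last exact: imset_f.
  by apply/imsetP; exists k.
rewrite /Qsym big_imset /=; last by move=> x y _ _; apply: f_inj.
by rewrite pair_big /=; apply: eq_bigl => kp; rewrite inE.
Qed.

(** A monomial has exactly one weakly increasing word, so its coefficient is 0 or 1 according to
    whether that word meets the conditions. *)
Lemma fundamental_sorted m (D : {set 'I_m.-1}) (w : seq nat) : sorted leq w ->
  fundamental D (seq_mset w) =
  (((size w == m) &&
    [forall k : 'I_m.-1, (k \in D) ==> (nth 0%N w k < nth 0%N w k.+1)%N])%:Z)%R.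
Proof.
move=> sw.
set b := (_ && _).
have rP (t : m.-tuple nat) :
  (forall k : 'I_m.-1, (nth 0%N t k <= nth 0%N t k.+1) /\
       (k \in D -> (nth 0%N t k < nth 0%N t k.+1))) /\ seq_mset t = seq_mset w
  <-> b /\ val t = w.
  split=> [[tD /eq_seq_msetP tw]|[/andP[szw /forallP wD] tw]].
    have E : val t = w.
      apply: (sorted_eq leq_trans anti_leq) => //.
      apply/(sortedP 0) => i; rewrite size_tuple => im.
      have im' : i < m.-1 by lia.
      by have [] := tD (Ordinal im').
    split=> //; apply/andP; split; first by rewrite -E size_tuple.
    by apply/forallP => k; apply/implyP => kD; rewrite -E; have [_] := tD k; apply.
  split=> [k|]; last by rewrite tw.
  rewrite tw; split; last by move/implyP: (wD k).
  by move/(sortedP 0): sw; apply; rewrite (eqP szw); have := ltn_ord k; lia.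
case: (boolP b) => hb; last first.
  rewrite [LHS](@gen_series_size _ _ _ _ [::]) // => t; split=> // /rP[].
  by rewrite (negbTE hb).
have szw : size w == m by case/andP: hb.
rewrite [LHS](@gen_series_size _ _ _ _ [:: Tuple szw]) // => t.
rewrite inE; split=> [/eqP->|/rP[_ tw]]; first exact/rP.
by apply/eqP; apply: val_inj.
Qed.

Lemma fundamental_size m (D : {set 'I_m.-1}) (u : monomial) :
  size u != m -> fundamental D u = 0%R.
Proof.
move=> um; have su : sorted leq (sort leq u) := sort_sorted leq_total u.
have <- : seq_mset (sort leq u) = u.
  by rewrite -[RHS]seq_mset_id; apply/eq_seq_msetP; rewrite perm_sort.
by rewrite fundamental_sorted // size_sort (negbTE um).
Qed.

(* Restricts to a rotation of {0, ..., M} under which the letters greater than v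
   come first. *)
Definition cyc_shift (M v y : nat) : nat :=
  if M < y then y else if v < y then y - v.+1 else y + (M - v).

(** Fixing the letters beyond [M] makes the relabelling a bijection of all variables, as needed to
    apply the symmetry of [Qsym A]. *)
Lemma cyc_shift_bij M v : v <= M -> bijective (cyc_shift M v).
Proof.
move=> vM; exists (fun y => if M < y then y else
                   if y < M - v then y + v.+1 else y - (M - v)) => y;
  rewrite /cyc_shift; do ![case: ifP]; lia.
Qed.

(** [undup] keeps the last copy of each letter, that is, the indices with no later occurrence. *)
Lemma big_undup_last (R : nmodType) (s : seq nat) (F : nat -> R) :
  (\sum_(i < size s | nth 0%N s i \notin drop i.+1 s) F (nth 0%N s i) =
   \sum_(x <- undup s) F x)%R.
Proof.
elim: s => [|x s IH]; first by rewrite big_nil big_ord0.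
rewrite big_mkcond big_ord_recl -big_mkcond /= drop0.
by case: (x \in s); rewrite /= ?big_cons ?add0r -IH.
Qed.

(* A rotation of the one-line notation of p followed by m, compared with the
   word w: rotate w back and remove the letter x of w facing m. The descent
   after m forces x to be the last copy of x in w, and the cyclic relabelling
   makes the rest of the rotated word weakly increasing again; no condition is
   lost at the junction, where the relabelled letters strictly increase. *)
Lemma fundamental_rotation m (p : 'S_m) (w : seq nat) (i : nat) :
  sorted leq w -> size w = m.+1 -> i <= m ->
  let x := nth 0 w i in
  fundamental (Des (Defs.rot_cycle m.+1 ^+ (m - i) * fix_last p)%g) (seq_mset w) =
  if x \in drop i.+1 w then 0%R
  else fundamental (Des p)
         (permute_vars (cyc_shift (nth 0 w m) x) (seq_mset w `\ x)%mset).
Proof.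
move=> sw szw im x; set M := nth 0 w m.
have /row_sortedP ws := sw.
have iw : i < size w by rewrite szw.
(* Rotating by [k] puts the value [m] at index [i]; [w2] lists the relabelled letters facing [p(0)],
   [p(1)], and so on. *)
pose k := m - i; pose w2 := map (cyc_shift M x) (drop i.+1 w ++ take i w).
have szd : size (drop i.+1 w) = k by rewrite size_drop szw /k; lia.
have sz2 : size w2 = m by rewrite size_map size_cat szd size_take iw /k; lia.
have wM j : j <= m -> nth 0 w j <= M by move=> jm; apply: ws; rewrite ?szw.
have xM : x <= M by apply: wM.
have -> : permute_vars (cyc_shift M x) (seq_mset w `\ x)%mset = seq_mset w2.
  apply/eq_seq_msetP; apply: perm_map.
  have -> : (seq_mset w `\ x)%mset = seq_mset (drop i.+1 w ++ take i w).
    rewrite -[RHS](msetD1K x) -mset_cons; congr (_ `\ _)%mset.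
    apply/eq_seq_msetP; rewrite -cat_cons -drop_nth // perm_sym.
    by rewrite perm_catC cat_take_drop.
  exact: perm_eq_seq_mset.
have w2E c : c < m -> nth 0 w2 c =
    cyc_shift M x (if c < k then nth 0 w (i.+1 + c) else nth 0 w (c - k)).
  move=> cm; rewrite (nth_map 0); last by rewrite -(size_map (cyc_shift M x)) sz2.
  rewrite nth_cat szd nth_drop; case: ifP => // ck.
  by rewrite nth_take //; rewrite /k in ck *; lia.
pose t := one_line (Defs.rot_cycle m.+1 ^+ (m - i) * fix_last p)%g.
pose P := one_line p.
have t1 j : j < i -> nth 0 t j = nth 0 P (j + k).
  move=> ji; rewrite rotation_fix_lastE ?leq_subr //; last first.
    by apply: leq_trans im; apply: ltnW.
  by rewrite ifT //; lia.
have t2 : nth 0 t i = m.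
  by rewrite rotation_fix_lastE ?leq_subr // subnKC // ltnn eqxx.
have t3 j : i < j -> j <= m -> nth 0 t j = nth 0 P (j - i.+1).
  move=> ij jm; rewrite rotation_fix_lastE ?leq_subr // ifF; last by lia.
  by rewrite ifF; [congr nth; lia | lia].
have Pm j : j < m -> nth 0 P j < m by apply: nth_one_line_lt.
have tD (j : 'I_m) : (j \in Des (Defs.rot_cycle m.+1 ^+ (m - i) * fix_last p)%g) =
    (nth 0 t j.+1 < nth 0 t j) by rewrite inE.
rewrite fundamental_sorted // szw eqxx /=.
case: (boolP (x \in drop i.+1 w)) => xd.
  have [c ck xc] : exists2 c, c < k & nth 0 w (i.+1 + c) = x.
    by move/(nthP 0): xd => [c cd <-]; exists c; rewrite ?nth_drop // -szd.
  have lim : i < m by rewrite /k in ck; lia.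
  case: forallP => // /(_ (Ordinal lim)).
  rewrite tD /= t2 t3 // subnn Pm /=; last lia.
  rewrite -/x => xw; have : nth 0 w i.+1 <= nth 0 w (i.+1 + c).
    by apply: ws; rewrite ?leq_addr // szw; rewrite /k in ck; lia.
  by rewrite xc leqNgt xw.
have xlt c : c < k -> x < nth 0 w (i.+1 + c).
  move=> ck; rewrite ltn_neqAle; apply/andP; split; last first.
    by apply: ws; rewrite ?szw /k in ck *; lia.
  by apply: contra xd => /eqP ->; rewrite -nth_drop mem_nth // szd.
have w2l c : c < k -> nth 0 w2 c = nth 0 w (i.+1 + c) - x.+1.
  move=> ck; rewrite w2E; last by rewrite /k in ck; lia.
  by rewrite ck /cyc_shift xlt // ltnNge wM //; rewrite /k in ck; lia.
have w2r c : k <= c -> c < m -> nth 0 w2 c = nth 0 w (c - k) + (M - x).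
  move=> kc cm; rewrite w2E // ltnNge kc /= /cyc_shift ltnNge wM /=; last lia.
  by rewrite ltnNge ws //; rewrite /k in kc *; lia.
(* The first [k] letters are now at most [M - x - 1] and the others at least [M - x], so the two
   blocks join strictly. *)
have s2 : sorted leq w2.
  apply/(sortedP 0) => c; rewrite sz2 => cm.
  case: (ltngtP c.+1 k) => ck.
  - rewrite !w2l ?(ltnW ck) //; apply: leq_sub2r.
    by apply: ws; [lia | rewrite szw /k in ck *; lia].
  - rewrite !w2r ?(ltnW ck) ?(ltnW cm) // leq_add2r.
    by apply: ws; [lia | rewrite szw; lia].
  - rewrite w2l -?ck // w2r -?ck //.
    have := wM (i.+1 + c); rewrite /k in ck; lia.
rewrite fundamental_sorted // sz2 eqxx /=; congr (nat_of_bool _)%:Z%R.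
apply/idP/idP => /forallP H; apply/forallP => c; apply/implyP.
  (* A position [c] of [p] corresponds to [i.+1 + c] or [c - k] in the rotation. For [c.+1 = k] the
     two letters lie at the opposite ends of the rotation, and the strict junction of [w2] settles
     the case. *)
  have cm : c.+1 < m by have := ltn_ord c; lia.
  rewrite inE -/P => Pc; case: (ltngtP c.+1 k) => ck.
  - have jm : i.+1 + c < m by rewrite /k in ck; lia.
    have := H (Ordinal jm); rewrite tD /= !t3; try lia.
    rewrite -addnS !addKn Pc /= !w2l ?(ltnW ck) //.
    have := xlt c; lia.
  - have jm : c - k < m by lia.
    have := H (Ordinal jm); rewrite tD /= !t1; try by rewrite /k in ck *; lia.
    rewrite addSn subnK // Pc /= !w2r ?(ltnW ck) ?(ltnW cm) //.
    by rewrite subSn // ltn_add2r.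
  - rewrite w2l -?ck // w2r -?ck //.
    have := xlt c; have := wM (i.+1 + c); rewrite /k in ck *; lia.
(* Conversely, the rotation has two positions not coming from [p]: the one before [m] is an ascent,
   and the one after [m] is a descent where [w] increases because [x] is a last copy. *)
have cm := ltn_ord c.
rewrite tD; case: (ltngtP c i) => ci.
- rewrite [nth 0 t c]t1 //; case: (ltngtP c.+1 i) => ci'.
  + rewrite t1 // => Pc.
    have jm : c + k < m.-1 by rewrite /k; lia.
    have := H (Ordinal jm); rewrite inE -/P /= Pc /= !w2r; try by rewrite /k; lia.
    by rewrite ltn_add2r -[(c + k).+1]addSn !addnK.
  + by lia.
  + by rewrite ci' t2; have := Pm (c + k); rewrite /k; lia.
- rewrite !t3; try lia.
  move=> Pc; have jm : c - i.+1 < m.-1 by lia.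
  have := H (Ordinal jm); rewrite inE -/P /= -subSn // Pc /=.
  rewrite !w2l; try by rewrite /k; lia.
  by rewrite !subnKC //; try lia.
- move=> _; rewrite ci; have := xlt 0; rewrite addn0; apply.
  by rewrite /k subn_gt0 -ci.
Qed.

Lemma Qsym_mul_rotationsE m (A : {set 'S_m}) :
  symmetric_function (Qsym A) -> Qsym (mul_rotations A) = series_mul (Qsym A) s1.
Proof.
move=> [_ symA]; apply: funext => u; rewrite Qsym_mul_rotations series_mul_s1.
(* Both sides are homogeneous of degree [m.+1]. *)
case: (eqVneq (size u) m.+1) => su; last first.
  rewrite big1 => [|k _]; last by rewrite big1 // => p _; apply: fundamental_size.
  rewrite big_seq big1 // => x; rewrite mem_undup => xu.
  rewrite /Qsym big1 // => p _; apply: fundamental_size.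
  by rewrite (size_msetB1 xu) in su.
set w := sort leq u.
have sw : sorted leq w := sort_sorted leq_total u.
have wu : perm_eq w u by rewrite perm_sort.
have uE : seq_mset w = u by rewrite -[RHS]seq_mset_id; apply/eq_seq_msetP.
have szw : size w = m.+1 by rewrite size_sort.
have /row_sortedP ws := sw.
have puw : perm_eq (undup u) (undup w).
  by apply: uniq_perm; rewrite ?undup_uniq // => x; rewrite !mem_undup (perm_mem wu).
(* Reversing the index replaces the rotation amount by the index [i] of the largest value, so both
   sums run over the positions of [w]. *)
rewrite (perm_big _ puw) /= -big_undup_last szw (reindex_inj rev_ord_inj) /=.
rewrite [RHS]big_mkcond /=; apply: eq_bigr => i _.
have im : i <= m by rewrite -ltnS.
have FE p := fundamental_rotation p sw szw im; rewrite /= uE in FE.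
rewrite subSS (eq_bigr _ (fun p _ => FE p)).
case: (boolP (_ \in _)) => xd /=; first by rewrite big1.
(* The relabelling depends on [w] and [i] but not on [p], so the symmetry of the whole sum over [A]
   removes it. *)
rewrite -(symA (cyc_shift (nth 0 w m) (nth 0 w i))) //.
by apply: cyc_shift_bij; apply: ws; rewrite ?szw.
Qed.

(* n = m.+1 *)
Theorem theorem2p1 (m : nat) (hn : (2 <= m.+1)%N) (A : {set 'S_m}) :
  schur_positive A ->
  schur_positive (mul_rotations A) /\
  Qsym (mul_rotations A) = series_mul (Qsym A) s1.
Proof.
move=> posA; have [symA _] := posA; have E := Qsym_mul_rotationsE symA.
by split=> //; rewrite /schur_positive E; apply: schur_positive_mul_s1.
Qed.
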